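(* Let $\mathcal{CL}=\{\ell_1,\dots,\ell_n,C_1,\dots,C_k\}\subset\mathbb{P}^2_{\mathbb{C}}$ be a conic-line arrangement, with $n\geq 1$ lines and $k\geq 1$ conics. Let $H$ be its Levi graph, $S_H=\mathbb{K}[a_v,b_v:v\in V(H)]$ over a field $\mathbb{K}$, and $J_H$ the binomial edge ideal of $H$. Then $S_H/J_H$ is not Cohen–Macaulay.
   Context: A conic-line arrangement $\mathcal{CL}=\{\ell_1,\dots,\ell_n,C_1,\dots,C_k\}$ is an arrangement of $n$ lines and $k$ smooth conics in $\mathbb{P}^2_{\mathbb{C}}$ having only ordinary singularities, i.e. every intersection point looks locally like $\{x^a=y^a\}$ for some integer $a\geq 2$. Its Levi graph $H$ is the bipartite graph with one vertex for each point $p\in\mathrm{Sing}(\mathcal{CL})$, one vertex for each line $\ell_j$ and for each conic $C_j$, and an edge between the vertex of $p$ and the vertex of a curve iff $p$ lies on that curve. For a graph with vertices labelled $1,\dots,m$, the binomial edge ideal $J\subseteq \mathbb{K}[a_1,\dots,a_m,b_1,\dots,b_m]$ is generated by $a_ib_j-a_jb_i$ for all edges $\{i,j\}$ with $i<j$. *)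

(* Defs.v *)
From HB Require Import structures.
From mathcomp Require Import all_boot all_order all_algebra.
From mathcomp Require Import reals.
From mathcomp Require Import complex.
From mathcomp Require Import mpoly.

Set Implicit Arguments.
Unset Strict Implicit.
Unset Printing Implicit Defensive.

Import GRing.Theory Num.Theory.
Local Open Scope ring_scope.

(* A point of P^2 is represented by a nonzero row vector p (its        *)
(* homogeneous coordinates); a line by a nonzero row vector l (the     *)
(* coefficients of its linear form); a conic by a symmetric 3x3 matrix *)
(* Q (the quadratic form x Q x^T).                                     *)

Section Plane.
Variable C : fieldType.

(* u and v are proportional (for nonzero vectors: define the same      *)
(* projective point / the same line): all 2x2 minors vanish.           *)
Definition proportional (u v : 'rV[C]_3) : bool :=
  [forall i, [forall j, u 0 i * v 0 j == u 0 j * v 0 i]].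

Definition proportional_mx (A B : 'M[C]_3) : bool :=
  [forall i, [forall j, [forall i', [forall j',
     A i j * B i' j' == A i' j' * B i j]]]].

Definition on_line (l p : 'rV[C]_3) : bool := (p *m l^T) 0 0 == 0.
Definition on_conic (Q : 'M[C]_3) (p : 'rV[C]_3) : bool :=
  (p *m Q *m p^T) 0 0 == 0.

Definition smooth_conic (Q : 'M[C]_3) : Prop := Q^T = Q /\ \det Q != 0.

Definition on_curve n k (lines : 'I_n -> 'rV[C]_3) (conics : 'I_k -> 'M[C]_3)
  (c : 'I_n + 'I_k) (p : 'rV[C]_3) : bool :=
  match c with
  | inl j => on_line (lines j) p
  | inr j => on_conic (conics j) p
  end.

(* Tangent line (as a linear form) of the curve c at a point p on it:
   the line itself, resp. the polar line p Q of p w.r.t. the conic. *)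
Definition tangent n k (lines : 'I_n -> 'rV[C]_3) (conics : 'I_k -> 'M[C]_3)
  (c : 'I_n + 'I_k) (p : 'rV[C]_3) : 'rV[C]_3 :=
  match c with
  | inl j => lines j
  | inr j => p *m conics j
  end.

Definition is_sing n k (lines : 'I_n -> 'rV[C]_3) (conics : 'I_k -> 'M[C]_3)
  (p : 'rV[C]_3) : Prop :=
  p != 0 /\ exists c1 c2, c1 != c2 /\
     on_curve lines conics c1 p /\ on_curve lines conics c2 p.

(* Conic-line arrangement with only ordinary singularities:
   - the lines are nonzero and pairwise distinct,
   - the conics are smooth and pairwise distinct,
   - ordinary singularities: at every point p lying on two distinct
     curves of the arrangement, these curves (which are smooth) have
     distinct tangent lines, i.e. all branches through p are smooth and
     pairwise transversal, so the singularity is locally x^a = y^a. *)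
Definition conic_line_arrangement n k (lines : 'I_n -> 'rV[C]_3)
  (conics : 'I_k -> 'M[C]_3) : Prop :=
  [/\ forall j, lines j != 0,
      forall j j', j != j' -> ~~ proportional (lines j) (lines j'),
      forall j, smooth_conic (conics j),
      forall j j', j != j' -> ~~ proportional_mx (conics j) (conics j')
    & forall p c1 c2, p != 0 -> c1 != c2 ->
        on_curve lines conics c1 p -> on_curve lines conics c2 p ->
        ~~ proportional (tangent lines conics c1 p) (tangent lines conics c2 p)].

Definition enumerates_sing n k (lines : 'I_n -> 'rV[C]_3)
  (conics : 'I_k -> 'M[C]_3) s (pts : 'I_s -> 'rV[C]_3) : Prop :=
  [/\ forall i, is_sing lines conics (pts i),
      forall i i', i != i' -> ~~ proportional (pts i) (pts i')
    & forall p, is_sing lines conics p -> exists i, proportional p (pts i)].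

Definition levi_vertex s n k := ('I_s + ('I_n + 'I_k))%type.

Definition levi_graph n k (lines : 'I_n -> 'rV[C]_3) (conics : 'I_k -> 'M[C]_3)
  s (pts : 'I_s -> 'rV[C]_3) : rel (levi_vertex s n k) :=
  fun u v =>
    match u, v with
    | inl i, inr c => on_curve lines conics c (pts i)
    | inr c, inl i => on_curve lines conics c (pts i)
    | _, _ => false
    end.

End Plane.

Section CommAlg.
Variables (K : fieldType) (N : nat).
Local Notation S := {mpoly K[N]}.

Definition is_ideal (I : S -> Prop) : Prop :=
  [/\ I 0, (forall f g, I f -> I g -> I (f + g)) & (forall f g, I g -> I (f * g))].

Definition subid (I J : S -> Prop) : Prop := forall f, I f -> J f.

Definition ideal_gen (G : S -> Prop) : S -> Prop :=
  fun f => forall I, is_ideal I -> subid G I -> I f.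

Definition prime_ideal (P : S -> Prop) : Prop :=
  [/\ is_ideal P, ~ P 1 & forall f g, P (f * g) -> P f \/ P g].

Definition maximal_ideal (M : S -> Prop) : Prop :=
  [/\ is_ideal M, ~ M 1 &
      forall I, is_ideal I -> subid M I -> subid I M \/ I 1].

(* Let A = S/J and M a maximal ideal of S containing J (i.e. a maximal
   ideal of A).  A local ring is Cohen-Macaulay iff depth = dimension. *)

(* dim A_M >= r : there is a chain P_0 < P_1 < ... < P_r of prime
   ideals of A contained in M (prime ideals of S between J and M). *)
Definition height_ge (J M : S -> Prop) (r : nat) : Prop :=
  exists P : nat -> (S -> Prop),
    (forall i, (i <= r)%N ->
       [/\ prime_ideal (P i), subid J (P i) & subid (P i) M]) /\
    (forall i, (i < r)%N -> subid (P i) (P i.+1) /\ ~ subid (P i.+1) (P i)).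

(* depth A_M >= r : there is an A_M-regular sequence of length r in the
   maximal ideal M A_M.  Its elements may be taken of the form x/1 with
   x in M.  Membership of f/1 in the ideal I A_M (I an ideal of S
   containing J) means: s f \in I for some s \notin M.  The condition
   A_M / (x_1..x_r) A_M <> 0 is automatic since all x_i are in M. *)
Definition loc_mem (M I : S -> Prop) (f : S) : Prop :=
  exists t, ~ M t /\ I (t * f).

Definition depth_ge (J M : S -> Prop) (r : nat) : Prop :=
  exists xs : seq S,
    [/\ size xs = r, (forall x, x \in xs -> M x) &
        forall i, (i < r)%N ->
          let I := ideal_gen (fun g => J g \/ g \in take i xs) in
          forall f, loc_mem M I (nth 0 xs i * f) -> loc_mem M I f].

(* S/J is Cohen-Macaulay: for every maximal ideal M of S/J, the local
   ring (S/J)_M has depth equal to its Krull dimension (compared as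
   suprema in nat \cup {oo}; both families of conditions are downward
   closed in r). *)
Definition cohen_macaulay_quot (J : S -> Prop) : Prop :=
  forall M, maximal_ideal M -> subid J M ->
    forall r, depth_ge J M r <-> height_ge J M r.

End CommAlg.

Section BEI.
Variables (K : fieldType) (V : finType).
Local Notation m := #|V|.
Local Notation S := {mpoly K[m + m]}.

Definition var_a (v : V) : S := 'X_(lshift m (enum_rank v)).
Definition var_b (v : V) : S := 'X_(rshift m (enum_rank v)).

Definition binomial_edge_ideal (E : rel V) : S -> Prop :=
  ideal_gen (fun g => exists u v, [/\ E u v, (enum_rank u < enum_rank v)%N &
                 g = var_a u * var_b v - var_a v * var_b u]).
End BEI.

(* Main.v *)
(* If a bipartite graph without isolated vertices or leaves has sides A and B
   with |A| <= |B|, its binomial edge ideal J is not Cohen-Macaulay at the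
   origin.  On one hand J lies in the kernel of a_v -> s u_v, b_v -> u_v, so
   the dimension is at least |V| + 1.  On the other hand, each v in B has two
   distinct neighbours w, w' in A, and the product f over B of the minors
   a_w b_w' - a_w' b_w is annihilated modulo J by
   P = (a_v, b_v : v in B).  Now S/P is a polynomial ring in 2|A| <= |V|
   variables, so |V| + 1 elements x of the maximal ideal satisfy a nonzero
   relation F(x) in P, whence F(x) f in J.  If x were a regular sequence, it
   would be quasi-regular: the leading form of F(x) would be a nonzerodivisor
   on the associated graded ring of (x), so f would lie in every power of (x),
   which is refuted by restricting f to curves through the origin.
   In a Levi graph, every line meets every conic in two distinct points by
   transversality, and every singular point is on two curves, so there are
   neither leaves nor isolated vertices. *)
Require Import Defs.
From HB Require Import structures.
From mathcomp Require Import all_boot all_order all_algebra.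
From mathcomp Require Import reals complex mpoly.
From mathcomp Require Import ring zify.
From Stdlib Require Import Classical.
Set Implicit Arguments.
Unset Strict Implicit.
Unset Printing Implicit Defensive.

Import Order.TTheory GRing.Theory Num.Theory.
Local Open Scope ring_scope.

(** * Regular sequences are quasi-regular *)

Section Filtration.
Variables (R : comNzRingType) (U : R -> Prop).
Hypotheses (U1 : U 1) (UM : forall s t, U s -> U t -> U (s * t)).

Definition idealp (I : R -> Prop) : Prop :=
  [/\ I 0, (forall f g, I f -> I g -> I (f + g)) & (forall f g, I g -> I (f * g))].

(* Membership of [f] in the localization of [I] at [U]. *)
Definition loc (I : R -> Prop) (f : R) : Prop := exists2 t, U t & I (t * f).

(** Degree [n - 1] of [Q], with the zero ideal in degree -1, so that both cases of [conv] unfold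
    alike in [convP]. *)
Definition prev_deg (Q : nat -> R -> Prop) n : R -> Prop :=
  if n is n'.+1 then Q n' else fun f => f = 0.

(* [conv x Q n] is the sum of the ideals x^j Q (n - j); if [Q] is the sequence of
   powers of an ideal I, it is the [n]-th power of I + (x). *)
Fixpoint conv x (Q : nat -> R -> Prop) n : R -> Prop := fun f =>
  exists q q', [/\ Q n q, (if n is n'.+1 then conv x Q n' q' else q' = 0) & f = q + x * q'].

Lemma convP x Q n f :
  conv x Q n f <-> exists q q', [/\ Q n q, prev_deg (conv x Q) n q' & f = q + x * q'].
Proof. by case: n. Qed.

Lemma idealB I f g : idealp I -> I f -> I g -> I (f - g).
Proof. by case=> _ ID IM If Ig; apply: ID => //; rewrite -mulN1r; apply: IM. Qed.

Lemma idealMr I f g : idealp I -> I f -> I (f * g).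
Proof. by case=> _ _ IM If; rewrite mulrC; apply: IM. Qed.

Lemma ideal_zero : idealp (fun f => f = 0).
Proof.
by split=> [//|f g -> ->|f g ->]; rewrite ?addr0 ?mulr0.
Qed.

Lemma prev_ideal Q n : (forall n, idealp (Q n)) -> idealp (prev_deg Q n).
Proof. by case: n => [|n] //= _; apply: ideal_zero. Qed.

Lemma loc_in (I : R -> Prop) f : I f -> loc I f.
Proof. by move=> If; exists 1; rewrite ?mul1r. Qed.

Lemma loc_sub (I J : R -> Prop) f : (forall g, I g -> J g) -> loc I f -> loc J f.
Proof. by move=> IJ [t Ut /IJ]; exists t. Qed.

Lemma locD I f g : idealp I -> loc I f -> loc I g -> loc I (f + g).
Proof.
move=> [_ ID IM] [s Us Is] [t Ut It]; exists (s * t); first exact: UM.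
have -> : s * t * (f + g) = t * (s * f) + s * (t * g) by ring.
by apply: ID; apply: IM.
Qed.

Lemma locMl I f g : idealp I -> loc I g -> loc I (f * g).
Proof.
move=> [_ _ IM] [t Ut It]; exists t => //.
by rewrite mulrCA; apply: IM.
Qed.

Lemma locB I f g : idealp I -> loc I f -> loc I g -> loc I (f - g).
Proof. by move=> iI If Ig; apply: locD => //; rewrite -mulN1r; apply: locMl. Qed.

Lemma loc_unit (I : R -> Prop) t f : U t -> loc I (t * f) -> loc I f.
Proof. by move=> Ut [s Us Isf]; exists (s * t); rewrite -?mulrA //; apply: UM. Qed.

Lemma conv_ideal x Q : (forall n, idealp (Q n)) -> forall n, idealp (conv x Q n).
Proof.
move=> iQ n; suff step m : idealp (prev_deg (conv x Q) m) -> idealp (conv x Q m).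
  by elim: n => [|n IHn]; apply: step => //; apply: ideal_zero.
have [Q0 QD QM] := iQ m; move=> [P0 PD PM]; split.
- by apply/convP; exists 0, 0; rewrite mulr0 addr0.
- move=> f g /convP[q [q' [Qq Pq' ->]]] /convP[r [r' [Qr Pr' ->]]].
  apply/convP; exists (q + r), (q' + r'); split; [exact: QD|exact: PD|ring].
- move=> f g /convP[q [q' [Qq Pq' ->]]].
  apply/convP; exists (f * q), (f * q'); split; [exact: QM|exact: PM|ring].
Qed.

Lemma conv_incl x (Q : nat -> R -> Prop) n f :
  (forall n, idealp (Q n)) -> Q n f -> conv x Q n f.
Proof.
move=> iQ Qf; apply/convP; exists f, 0; rewrite mulr0 addr0; split=> //.
by case: (prev_ideal n (conv_ideal x iQ)).
Qed.

Lemma conv_shift x (Q : nat -> R -> Prop) n f :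
  (forall n, idealp (Q n)) -> conv x Q n f -> conv x Q n.+1 (x * f).
Proof.
move=> iQ Qf; apply/convP; exists 0, f; rewrite add0r; split=> //.
by case: (iQ n.+1).
Qed.

Lemma conv_prev x (Q : nat -> R -> Prop) n f :
  (forall n, idealp (Q n)) -> prev_deg (conv x Q) n f -> conv x Q n (x * f).
Proof.
case: n => [|n] iQ /=; last exact: conv_shift.
by move=> ->; rewrite mulr0; exists 0, 0; rewrite mulr0 addr0; case: (iQ 0%N).
Qed.

Lemma conv_mono x (Q T : nat -> R -> Prop) n f :
  (forall n f, T n f -> Q n f) -> conv x T n f -> conv x Q n f.
Proof.
move=> TQ; elim: n f => [|n IHn] f [q [q' [Tq Tq' ->]]]; exists q, q'; split=> //.
- exact: TQ.
- exact: TQ.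
- exact: IHn.
Qed.

Lemma conv_mul x (A B C : nat -> R -> Prop) :
  (forall n, idealp (C n)) ->
  (forall a b f g, A a f -> B b g -> C (a + b)%N (f * g)) ->
  forall a b f g, conv x A a f -> conv x B b g -> conv x C (a + b)%N (f * g).
Proof.
move=> iC ABC; have iC' := conv_ideal x iC.
have step a b f g : A a f -> conv x B b g -> conv x C (a + b)%N (f * g).
  move=> Af; elim: b g => [|b IHb] g [q [q' [Bq Bq' ->]]].
    by rewrite Bq' mulr0 addr0; apply: conv_incl => //; apply: ABC.
  rewrite mulrDr mulrCA; have [_ CD _] := iC' (a + b.+1)%N; apply: CD.
    by apply: conv_incl => //; apply: ABC.
  by rewrite addnS; apply: conv_shift => //; apply: IHb.
elim=> [|a IHa] b f g [q [q' [Aq Aq' ->]]] Bg.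
  by rewrite Aq' mulr0 addr0; apply: step.
rewrite mulrDl -mulrA; have [_ CD _] := iC' (a.+1 + b)%N; apply: CD.
  exact: step.
by rewrite addSn; apply: conv_shift => //; apply: IHa.
Qed.

(* For [Q] a filtration and an ideal [a], [T n] stands for [a * Q n + Q n.+1],
   so that [Q n / T n] is the degree [n] part of [gr Q / a gr Q]. *)
Record filtration_pair (Q T : nat -> R -> Prop) : Prop := FiltrationPair {
  fpQ : forall n, idealp (Q n);
  fpT : forall n, idealp (T n);
  fpS : forall n f, Q n.+1 f -> T n f;
  fpTQ : forall n f, T n f -> Q n f;
  fpMQ : forall a b f g, Q a f -> Q b g -> Q (a + b)%N (f * g);
  fpMT : forall a b f g, Q a f -> T b g -> T (a + b)%N (f * g);
  fp0 : forall f, Q 0%N f }.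

(** [T 0 x] says that [x] lies in the ideal a. It is what puts the multiples [x * q'], which have
    degree 1 in the new filtration, into degree 0 of [conv x T]. *)
Lemma fp_conv Q T x : filtration_pair Q T -> T 0%N x ->
  filtration_pair (conv x Q) (conv x T).
Proof.
case=> iQ iT QST TQ QQ QT Q0 T0x; split.
- exact: conv_ideal.
- exact: conv_ideal.
- elim=> [|n IHn] f [q [q' [Qq Qq' ->]]].
    apply/convP; exists (q + x * q'), 0; rewrite mulr0 addr0; split=> //.
    have [_ TD _] := iT 0%N; apply: TD; first exact: QST.
    exact: idealMr.
  by apply/convP; exists q, q'; split=> //; [apply: QST|apply: IHn].
- by move=> n f; apply: conv_mono.
- by move=> a b f g; apply: (conv_mul (A := Q) (B := Q) (C := Q)).
- by move=> a b f g; apply: (conv_mul (A := Q) (B := T) (C := T)).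
- by move=> f; apply: conv_incl.
Qed.

(* [g] acts as a nonzerodivisor of degree [e] on [gr Q / a gr Q]. *)
Definition gr_regular (Q T : nat -> R -> Prop) e g : Prop :=
  forall c z, Q c z -> loc (T (e + c)%N) (g * z) -> loc (T c) z.

(** * Adjoining one element: the graded ring gains a variable *)

Section Step.
Variables (Q T : nat -> R -> Prop) (x : R).
Hypotheses (QT : filtration_pair Q T) (T0x : T 0%N x).
Hypothesis x_reg : gr_regular Q (fun n => Q n.+1) 0 x.

Let QT' := fp_conv QT T0x.

(** The nonzerodivisor property passes from the layers [Q i / Q i.+1] to [R / Q n] by induction on
    [n]. *)
Lemma filt_nzd n z : loc (Q n) (x * z) -> loc (Q n) z.
Proof.
elim: n z => [|n IHn] z; first by move=> _; apply/loc_in/(fp0 QT).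
move=> Qxz.
have [t Ut Qtz] : loc (Q n) z.
  by apply: IHn; apply: loc_sub Qxz => f /(fpS QT) /(fpTQ QT).
apply: (loc_unit Ut); apply: (x_reg Qtz); rewrite add0n mulrCA.
by apply: locMl => //; apply: fpQ QT _.
Qed.

Lemma T_conv n f : T n f -> conv x T n f.
Proof. exact/conv_incl/(fpT QT). Qed.

(** Modulo a, the graded ring of [conv x Q] behaves as the polynomial ring in the class of [x] over
    that of [Q]: a vanishing polynomial has zero lowest coefficient. Powers of [x] are cancelled
    with [filt_nzd]. *)
Lemma lowest_coef k n p p' : Q n p -> prev_deg (conv x Q) n p' ->
  loc (conv x T (k + n)%N) (x ^+ k * (p + x * p')) -> loc (T n) p.
Proof.
elim: k => [|k IHk] Qp Qp'.
  rewrite expr0 mul1r add0n => -[t Ut /convP[r [r' [Tr Tr' e]]]].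
  apply: (loc_unit Ut); case: n => [|n] in Qp Qp' Tr Tr' *.
    move: Qp' Tr' => /= p'0 r'0; move: e; rewrite p'0 r'0 !mulr0 !addr0 => ->.
    exact: loc_in.
  (* Since [x * (t * p' - r')] equals [r - t * p], it lies in [Q n.+1]. Once [x] is cancelled,
     [s * t * p] differs from an element of [T n.+1] by [x] times an element of [Q n.+1], and [x] is
     in [T 0]. *)
  have [s Us Qs] : loc (Q n.+1) (t * p' - r').
    apply: filt_nzd; apply: loc_in.
    have -> : x * (t * p' - r') = r - t * p.
      apply/eqP; rewrite -subr_eq0; apply/eqP.
      by transitivity (t * (p + x * p') - (r + x * r')); [ring|rewrite e subrr].
    by apply: idealB; [exact: (fpQ QT)|exact: (fpTQ QT)|case: (fpQ QT n.+1) => _ _; apply].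
  apply: (loc_unit Us); apply: loc_in.
  have -> : s * (t * p) = s * r - x * (s * (t * p' - r')).
    apply/eqP; rewrite -subr_eq0; apply/eqP.
    by transitivity (s * (t * (p + x * p') - (r + x * r'))); [ring|rewrite e subrr mulr0].
  apply: idealB; [exact: (fpT QT)|by case: (fpT QT n.+1) => _ _; apply|].
  by rewrite mulrC -[n.+1]addn0; apply: (fpMT QT).
move=> -[t Ut]; rewrite addSn => -[r [r' [Tr Tr' e]]].
apply: IHk => //.
have [s Us Qs] : loc (Q (k + n).+1) (t * (x ^+ k * (p + x * p')) - r').
  apply: filt_nzd; apply: loc_in.
  have -> : x * (t * (x ^+ k * (p + x * p')) - r') = r.
    by apply: (addIr (x * r')); rewrite -e exprS; ring.
  exact: (fpTQ QT).
exists (s * t); first exact: UM.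
have -> : s * t * (x ^+ k * (p + x * p')) =
   s * r' + s * (t * (x ^+ k * (p + x * p')) - r') by ring.
have [_ TD TM] := fpT QT' (k + n)%N.
apply: TD; first exact: TM.
by apply: T_conv; apply: (fpS QT).
Qed.

Lemma conv_expl a b f : conv x Q b f -> conv x Q (a + b)%N (x ^+ a * f).
Proof.
elim: a => [|a IHa] Qf; first by rewrite mul1r.
by rewrite exprS -mulrA; apply: conv_shift (fpQ QT) _; apply: IHa.
Qed.

Lemma conv_lead e i g h h' :
  Q e g -> prev_deg (conv x Q) e h -> conv x Q (i + e).+1 h' ->
  conv x Q (i + e)%N (x ^+ i * (g + x * h) + h').
Proof.
move=> Qg Qh Qh'; have [_ QD _] := fpQ QT' (i + e)%N; apply: QD.
  apply: conv_expl; have [_ QD _] := fpQ QT' e; apply: QD.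
    exact/conv_incl/Qg/(fpQ QT).
  exact: conv_prev (fpQ QT) _.
by apply: (fpTQ QT'); apply: (fpS QT').
Qed.

(** A polynomial whose lowest coefficient is a nonzerodivisor is a nonzerodivisor. The lowest term
    is [x ^+ i * g], [h] collects the higher powers of [x], and [h'] has too large a degree to
    affect the leading form. *)
Lemma gr_regular_conv e i g h h' :
  Q e g -> gr_regular Q T e g ->
  prev_deg (conv x Q) e h -> conv x Q (i + e).+1 h' ->
  gr_regular (conv x Q) (conv x T) (i + e) (x ^+ i * (g + x * h) + h').
Proof.
move=> Qg g_reg Qh Qh' c z Qz Tz.
set G := x ^+ i * _ + h' in Tz.
have iQ' := fpQ QT'; have iT' := fpT QT'.
have pmul a b f q : conv x Q a f -> prev_deg (conv x Q) b q ->
    prev_deg (conv x Q) (a + b)%N (f * q).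
  case: b => [|b] Qf /=; first by move=> ->; rewrite mulr0; case: (prev_ideal (a + 0)%N iQ').
  by rewrite addnS; apply: (fpMQ QT').
have xpowT a b f : conv x T b f -> conv x T (a + b)%N (x ^+ a * f).
  elim: a => [|a IHa] Qf; first by rewrite mul1r.
  by rewrite exprS -mulrA; apply: conv_shift (fpT QT) _; apply: IHa.
have QG : conv x Q (i + e)%N G by apply: conv_lead.
(* The lowest coefficient of [G * (x ^+ j * w)] is [g * p], at exponent [i + j]; the contribution of
   [h'] lies in a higher degree. *)
have lead n j w p p' : (j + n)%N = c -> Q n p -> prev_deg (conv x Q) n p' -> w = p + x * p' ->
    loc (conv x T (i + e + c)%N) (G * (x ^+ j * w)) -> loc (T n) p.
  move=> jn Qp Qp' def_w TGw.
  have Qw : conv x Q n w by apply/convP; exists p, p'.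
  apply: g_reg => //; apply: (@lowest_coef (i + j) (e + n) _ (g * p' + h * w)).
  - exact: (fpMQ QT).
  - have [_ PD _] := prev_ideal (e + n) iQ'; apply: PD.
      by apply: pmul => //; apply/conv_incl/Qg/(fpQ QT).
    by rewrite mulrC addnC; apply: pmul.
  have -> : x ^+ (i + j) * (g * p + x * (g * p' + h * w)) =
            G * (x ^+ j * w) - h' * (x ^+ j * w).
    by rewrite /G exprD def_w; ring.
  rewrite addnACA jn; apply: locB => //; apply: loc_in; apply: (fpS QT').
  by rewrite -addSn; apply: (fpMQ QT') => //; rewrite -jn; apply: conv_expl.
(* Induction on the degree [n] left after extracting [x ^+ j]: [lead] disposes of the lowest
   coefficient [p], and the rest is divisible by one more [x]. *)
suff main n j w : (j + n)%N = c -> conv x Q n w ->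
    loc (conv x T (i + e + c)%N) (G * (x ^+ j * w)) -> loc (conv x T c) (x ^+ j * w).
  by move: (main c 0%N z); rewrite !mul1r; apply.
elim: n j w => [|n IHn] j w jn /convP[p [p' [Qp Qp' def_w]]] TGw.
all: have [t Ut Ttp] := lead _ _ _ _ _ jn Qp Qp' def_w TGw.
all: have Tp : conv x T c (x ^+ j * (t * p)) by rewrite -jn; apply/xpowT/T_conv.
  move: Qp' => /= p'0; exists t => //.
  by rewrite mulrCA def_w p'0 mulr0 addr0.
apply: (loc_unit Ut).
have -> : t * (x ^+ j * w) = x ^+ j * (t * p) + x ^+ j.+1 * (t * p').
  by rewrite def_w exprS; ring.
apply: locD => //; first exact: loc_in.
apply: IHn; first by rewrite addSnnS.
  by case: (iQ' n) => _ _; apply.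
have -> : G * (x ^+ j.+1 * (t * p')) = t * (G * (x ^+ j * w)) - G * (x ^+ j * (t * p)).
  by rewrite def_w exprS; ring.
apply: locB => //; first exact: locMl.
exact/loc_in/(fpMT QT').
Qed.
End Step.

(** * Powers of the ideal generated by a regular sequence *)

Variables (J : R -> Prop).
Hypothesis iJ : idealp J.

(** The case of the empty sequence: powers of the zero ideal of [R / J] when [I] is everything, and
    in general the companion family [T] attached to [I]. *)
Definition base (I : R -> Prop) n : R -> Prop := if n is 0%N then I else J.

(** If [I] is everything, degree [n] is J + (ys)^n. If [I] is an ideal containing [J] and [ys],
    degree [n] is J + I (ys)^n, which contains (ys)^(n+1). *)
Definition filt I ys : nat -> R -> Prop := foldr conv (base I) ys.

Local Notation full := (fun=> True).
Local Notation Qf := (filt full).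

Fixpoint ideal_span ys : R -> Prop :=
  if ys is x :: ys' then fun f => exists a b, ideal_span ys' a /\ f = a + x * b else J.

(* The head of the list is the last element of the regular sequence. *)
Fixpoint regular ys : Prop :=
  if ys is x :: ys' then
    regular ys' /\ forall z, loc (ideal_span ys') (x * z) -> loc (ideal_span ys') z
  else True.

Lemma ideal_span_ideal ys : idealp (ideal_span ys).
Proof.
elim: ys => [//|x ys [S0 SD SM]] /=; split.
- by exists 0, 0; rewrite mulr0 addr0.
- move=> f g [a [b [Sa ->]]] [c [d [Sc ->]]]; exists (a + c), (b + d).
  by split; [exact: SD|ring].
- move=> f g [a [b [Sa ->]]]; exists (f * a), (f * b).
  by split; [exact: SM|ring].
Qed.

Lemma span_base ys f : J f -> ideal_span ys f.
Proof.
by elim: ys => //= x ys IHys /IHys; exists f, 0; rewrite mulr0 addr0.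
Qed.

Lemma span_mem ys y : y \in ys -> ideal_span ys y.
Proof.
elim: ys => //= x ys IHys; rewrite inE => /predU1P[->|/IHys Sy].
  by exists 0, 1; rewrite mulr1 add0r; split=> //; case: (ideal_span_ideal ys).
by exists y, 0; rewrite mulr0 addr0.
Qed.

Section Ideal.
Variable I : R -> Prop.
Hypotheses (iI : idealp I) (JI : forall f, J f -> I f).

Lemma fp_base : filtration_pair (base full) (base I).
Proof.
have [_ _ JM] := iJ; have [_ _ IM] := iI.
split=> //=.
- by case.
- by case.
- by case=> //= f; apply: JI.
- by case.
- case=> [|a] [|b] f g //= ? ?; first exact: JM.
  exact: idealMr.
  by apply: JM.
- case=> [|a] [|b] f g //= ? ?; first exact: IM.
  + exact: JM.
  + exact: idealMr.
  + exact: JM.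
Qed.

Lemma filt_ideal ys n : idealp (filt I ys n).
Proof.
elim: ys n => [|x ys IHys] n /=; first by case: n.
exact: conv_ideal.
Qed.

Lemma filt0 ys f : I f -> filt I ys 0%N f.
Proof.
elim: ys => //= x ys IHys /IHys; apply: conv_incl => n; exact: filt_ideal.
Qed.

Lemma filt_base ys n f : J f -> filt I ys n f.
Proof.
move=> Jf; elim: ys => [|x ys IHys]; first by case: n => //; apply: JI.
by apply: conv_incl => // m; apply: filt_ideal.
Qed.

Lemma fp_filt ys : (forall y, y \in ys -> I y) -> filtration_pair (Qf ys) (filt I ys).
Proof.
elim: ys => [_|x ys IHys Iys]; first exact: fp_base.
apply: fp_conv; first by apply: IHys => y ysy; apply: Iys; rewrite inE ysy orbT.
by apply/filt0/Iys/mem_head.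
Qed.

(** [filt I ys n] is generated by [I * Qf ys n] and [Qf ys n.+1], so an inclusion need only be
    tested on these. *)
Lemma filt_least ys (W : nat -> R -> Prop) : (forall n, idealp (W n)) ->
  (forall n f q, I f -> Qf ys n q -> W n (f * q)) ->
  (forall n q, Qf ys n.+1 q -> W n q) ->
  forall n f, filt I ys n f -> W n f.
Proof.
have iF zs m : idealp (Qf zs m).
  elim: zs m => [|z zs IHzs] m; last exact: conv_ideal.
  by case: m.
elim: ys W => [|x ys IHys] W iW WM WS n.
  case: n => [|n] f /= Hf; first by rewrite -[f]mulr1; apply: WM.
  exact: WS.
elim: n W iW WM WS => [|n IHn] W iW WM WS f [q [q' [Fq Fq' ->]]].
  rewrite Fq' mulr0 addr0; apply: IHys Fq => // m.
    by move=> f' r If' Qr; apply: WM => //; apply: conv_incl.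
  by move=> r Qr; apply: WS; apply: conv_incl.
have [_ WD _] := iW n.+1; apply: WD.
  apply: IHys Fq => // m.
    by move=> f' r If' Qr; apply: WM => //; apply: conv_incl.
  by move=> r Qr; apply: WS; apply: conv_incl.
(* The factor [x] is absorbed by passing to the colon ideals [W m.+1 : x], which satisfy the same
   conditions. *)
apply: (IHn (fun m g => W m.+1 (x * g))) => // [m|m f' r If' Qr|m r Qr].
- have [W0 WD' WM'] := iW m.+1; split; first by rewrite mulr0.
    by move=> g h Wg Wh; rewrite mulrDr; apply: WD'.
  by move=> g h Wh; rewrite mulrCA; apply: WM'.
- by rewrite mulrCA; apply: WM => //; apply: conv_shift.
- by apply: WS; apply: conv_shift.
Qed.
End Ideal.

Lemma filt_full0 ys f : Qf ys 0%N f.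
Proof. by apply: filt0. Qed.

Lemma span_filt1 ys f : ideal_span ys f -> Qf ys 1%N f.
Proof.
elim: ys f => [//|x ys IHys] f [a [b [Sa ->]]].
exists a, b; split=> //; first exact: IHys.
exact: (@filt_full0 (x :: ys)).
Qed.

(** Multiplication by (ys) raises the degree by one, so reducing the graded ring modulo (ys) changes
    nothing. *)
Lemma filt_span ys n f : filt (ideal_span ys) ys n f -> Qf ys n.+1 f.
Proof.
have fp := fp_filt (ideal_span_ideal ys) (@span_base ys) (@span_mem ys).
apply: (@filt_least _ _ (fun n => Qf ys n.+1)) => // {}n.
  exact: (fpQ fp).
by move=> {}f q /span_filt1 Sf Qq; rewrite -add1n; apply: (fpMQ fp).
Qed.

Lemma span_gr_regular ys x : gr_regular (Qf ys) (filt (ideal_span ys) ys) 0 x ->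
  gr_regular (Qf ys) (fun n => Qf ys n.+1) 0 x.
Proof.
move=> x_reg c z Qz Qxz; apply: loc_sub (@filt_span ys c) _.
apply: x_reg => //; apply: loc_sub Qxz => f.
exact: (fpS (fp_filt (ideal_span_ideal ys) (@span_base ys) (@span_mem ys))).
Qed.

(** Modulo [I] the graded ring is a polynomial ring over [R / I], where a nonzerodivisor of [R / I]
    stays one. The induction hypothesis serves twice: with the span of the tail and [x], to adjoin
    [x], then with [I] and [y] themselves. *)
Lemma regular_filt ys (I : R -> Prop) y : regular ys -> idealp I ->
  (forall f, J f -> I f) -> (forall x, x \in ys -> I x) ->
  (forall z, loc I (y * z) -> loc I z) ->
  gr_regular (Qf ys) (filt I ys) 0 y.
Proof.
elim: ys I y => [|x ys IHys] I y.
  move=> _ iI JI _ Iy [|c] z Qz /=; first exact: Iy.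
  by move=> _; apply: loc_in.
move=> [ys_reg x_reg] iI JI Iys Iy.
have Iys' z : z \in ys -> I z by move=> ysz; apply: Iys; rewrite inE ysz orbT.
have fp := fp_filt iI JI Iys'.
have x_reg' := span_gr_regular
  (IHys _ _ ys_reg (ideal_span_ideal ys) (@span_base ys) (@span_mem ys) x_reg).
have Ix : filt I ys 0%N x by apply/filt0/Iys/mem_head.
have := @gr_regular_conv _ _ _ fp Ix x_reg' 0 0 y 0 0.
rewrite mulr0 !addr0 mul1r; apply => //.
- exact: fp0 fp _.
- exact: IHys.
- by case: (fpQ (fp_conv fp Ix) 1%N).
Qed.

Lemma regular_head x ys : regular (x :: ys) ->
  gr_regular (Qf ys) (fun n => Qf ys n.+1) 0 x.
Proof.
case=> ys_reg x_reg; apply: span_gr_regular.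
exact: regular_filt ys_reg (ideal_span_ideal ys) (@span_base ys) (@span_mem ys) x_reg.
Qed.

Fixpoint mon ys (m : seq nat) : R :=
  match ys, m with
  | x :: ys', i :: m' => x ^+ i * mon ys' m'
  | _, _ => 1
  end.

(* Elements whose leading form comes after the monomial of exponent [m], for
   the order comparing total degrees first, then exponents from the head. *)
Fixpoint higher ys (m : seq nat) : R -> Prop :=
  match ys, m with
  | x :: ys', i :: m' => fun f => exists g h h',
      [/\ higher ys' m' g, prev_deg (Qf ys) (sumn m') h, Qf ys (i + sumn m').+1 h'
        & f = x ^+ i * (g + x * h) + h']
  | _, _ => J
  end.

Lemma fpQf ys : filtration_pair (Qf ys) (Qf ys).
Proof. exact: fp_filt. Qed.

Lemma higher_ideal ys m : idealp (higher ys m).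
Proof.
elim: ys m => [|x ys IHys] [|i m] //=; have [H0 HD HM] := IHys m.
have iQ := fpQ (fpQf (x :: ys)).
have [P0 PD PM] := prev_ideal (sumn m) iQ.
have [Q0 QD QM] := iQ (i + sumn m).+1.
split.
- by exists 0, 0, 0; split=> //; rewrite mulr0 !addr0 mulr0.
- move=> f f' [g [h [k [Hg Ph Qk ->]]]] [g' [h' [k' [Hg' Ph' Qk' ->]]]].
  exists (g + g'), (h + h'), (k + k').
  by split; [exact: HD|exact: PD|exact: QD|ring].
- move=> c f [g [h [k [Hg Ph Qk ->]]]].
  exists (c * g), (c * h), (c * k).
  by split; [exact: HM|exact: PM|exact: QM|ring].
Qed.

Lemma filt_mon ys m : size m = size ys -> Qf ys (sumn m) (mon ys m).
Proof.
elim: ys m => [|x ys IHys] [|i m] //= [/IHys Qm].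
apply: (conv_expl (fpQf ys)).
by apply: conv_incl => //; apply: (fpQ (fpQf ys)).
Qed.

Lemma filt_decr ys a b f : (a <= b)%N -> Qf ys b f -> Qf ys a f.
Proof.
move=> /subnKC <-; elim: (b - a)%N f => [|k IHk] f; first by rewrite addn0.
by rewrite addnS => Qf'; apply/IHk/(fpS (fpQf ys)).
Qed.

Lemma higher_mon ys m m' : size m = size ys -> size m' = size ys ->
  (sumn m < sumn m')%N \/ sumn m = sumn m' /\ (exists2 k, forall j, (j < k)%N ->
     nth 0%N m j = nth 0%N m' j & (nth 0%N m k < nth 0%N m' k)%N) ->
  higher ys m (mon ys m').
Proof.
elim: ys m m' => [|x ys IHys] [|i m] [|i' m'] // sm sm'.
  by case=> // -[_ [k _]]; rewrite !nth_nil.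
have [H0 _ _] := higher_ideal ys m; have iQ := fpQ (fpQf (x :: ys)).
have [P0 _ _] := prev_ideal (sumn m) iQ.
have [Q0 _ _] := iQ (i + sumn m).+1.
case=> [lt_m|[eq_m [[|k] eq_nth lt_nth]]].
- exists 0, 0, (mon (x :: ys) (i' :: m')); split=> //.
    by apply: filt_decr lt_m _; apply: filt_mon.
  by rewrite mulr0 addr0 mulr0 add0r.
- rewrite /= in lt_nth eq_m; exists 0, (x ^+ (i' - i).-1 * mon ys m'), 0; split=> //.
    have -> : sumn m = ((i' - i).-1 + sumn m').+1.
      by rewrite -addSn prednK ?subn_gt0 //; apply: (@addnI i);
         rewrite addnA subnKC // ltnW.
    exact: (@filt_mon (x :: ys) ((i' - i).-1 :: m')).
  rewrite add0r addr0 /= [x * _]mulrA -exprS prednK ?subn_gt0 // mulrA -exprD.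
  by rewrite subnKC // ltnW.
- have /= eq_i := eq_nth 0%N isT; exists (mon ys m'), 0, 0; split=> //.
    apply: IHys; [by case: sm|by case: sm'|right; split].
      by move: eq_m; rewrite /= -eq_i => /addnI.
    by exists k => // j ltj; apply: (eq_nth j.+1).
  by rewrite mulr0 !addr0 eq_i.
Qed.

(** [gr_regular_conv] is iterated along [ys]: the lowest coefficient with respect to the head has
    the same shape for the tail, down to the unit [c] modulo [J]. *)
Lemma gr_regular_lead ys (I : R -> Prop) c m r : regular ys -> idealp I ->
  (forall f, J f -> I f) -> (forall x, x \in ys -> I x) ->
  (exists c', c' * c = 1) -> size m = size ys -> higher ys m r ->
  Qf ys (sumn m) (c * mon ys m + r) /\
  gr_regular (Qf ys) (filt I ys) (sumn m) (c * mon ys m + r).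
Proof.
move=> ys_reg iI JI Iys [c' c'c].
elim: ys m r ys_reg Iys => [|x ys IHys] [|i m] r ys_reg Iys //= sz Hr.
  split=> // -[|k] z Qz /=; last by move=> _; apply: loc_in.
  rewrite mulr1 => Iz.
  have -> : z = c' * ((c + r) * z - r * z) by rewrite mulrDl addrK mulrA c'c mul1r.
  apply: locMl => //; apply: locB => //; apply: loc_in.
  by apply: idealMr => //; apply: JI.
have Iys' y : y \in ys -> I y by move=> ysy; apply: Iys; rewrite inE ysy orbT.
have [ys_reg' _] := ys_reg.
case: sz => sz; move: Hr => [g [h [h' [Hg Ph Qh' ->]]]].
have [Qg g_reg] := IHys m g ys_reg' Iys' sz Hg.
have fp := fp_filt iI JI Iys'.
have Ix : filt I ys 0%N x by apply/filt0/Iys/mem_head.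
have -> : c * (x ^+ i * mon ys m) + (x ^+ i * (g + x * h) + h') =
          x ^+ i * ((c * mon ys m + g) + x * h) + h' by ring.
split; first exact: (conv_lead fp Ix).
by apply: (gr_regular_conv fp Ix) => //; apply: regular_head.
Qed.

(** The product with [f] lies in [J], hence in every degree of the filtration. As the first factor
    is a nonzerodivisor on the graded ring, [f] climbs from each degree to the next. *)
Lemma regular_annihilated ys c m r f : regular ys ->
  (exists c', c' * c = 1) -> size m = size ys -> higher ys m r ->
  J ((c * mon ys m + r) * f) -> forall n, loc (Qf ys n) f.
Proof.
move=> ys_reg c_unit sz Hr Jf.
have [[iS JS] ysS] := (ideal_span_ideal ys, @span_base ys, @span_mem ys).
have [_ g_reg] := gr_regular_lead ys_reg iS JS ysS c_unit sz Hr.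
elim=> [|n [t Ut Qtf]]; first exact/loc_in/filt_full0.
apply: (loc_unit Ut); apply: loc_sub (@filt_span ys n) _.
apply: g_reg => //; apply/loc_in/filt_base => //; rewrite mulrCA.
by case: iJ => _ _; apply.
Qed.

(** Bounds the order of an element in the filtration by its order of vanishing along a curve on
    which [J] vanishes. *)
Lemma filt_order (D : comNzRingType) (psi : {rmorphism R -> {poly D}}) ys n f :
  (forall j, J j -> psi j = 0) ->
  (forall y, y \in ys -> exists h, psi y = 'X * h) ->
  Qf ys n f -> exists h, psi f = 'X^n * h.
Proof.
move=> psiJ; elim: ys n f => [|x ys IHys] n f psiX.
  case: n => [|n] /=; first by exists (psi f); rewrite mul1r.
  by move=> /psiJ ->; exists 0; rewrite mulr0.
have [hx def_x] := psiX x (mem_head _ _).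
have IH k q : Qf ys k q -> exists h, psi q = 'X^k * h.
  by apply: IHys => y ysy; apply: psiX; rewrite inE ysy orbT.
elim: n f => [|n IHn] f [q [q' [Qq Qq' ->]]]; have [h def_q] := IH _ _ Qq.
  by exists h; rewrite Qq' mulr0 addr0.
have [h' def_q'] := IHn _ Qq'; exists (h + hx * h').
by rewrite rmorphD rmorphM /= def_q def_q' def_x exprS; ring.
Qed.
End Filtration.

(** * Algebraic dependence *)

Lemma msize_mmap1_le (K : fieldType) d r (p : 'I_r -> {mpoly K[d]}) delta (m : 'X_{1..r}) :
  (forall i, msize (p i) <= delta.+1)%N -> (msize (mmap1 p m) <= (delta * mdeg m).+1)%N.
Proof.
move=> p_le; rewrite /mmap1 mdegE big_distrr /=.
have msizeM1 (q q' : {mpoly K[d]}) a b : (msize q <= a.+1 -> msize q' <= b.+1 ->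
    msize (q * q') <= (a + b).+1)%N.
  move=> qa qb'.
  have [-> | q0] := eqVneq q 0; first by rewrite mul0r msize0.
  have [-> | q'0] := eqVneq q' 0; first by rewrite mulr0 msize0.
  have le_pred x y : (x <= a.+1 -> y <= b.+1 -> (x + y).-1 <= (a + b).+1)%N by lia.
  by rewrite msizeM //; apply: le_pred.
apply: (big_ind2 (fun (q : {mpoly K[d]}) a => msize q <= a.+1)%N).
- by rewrite msizeC oner_eq0.
- by move=> q a q' b; apply: msizeM1.
move=> i _; elim: (m i) => [|k IHk]; first by rewrite muln0 expr0 msizeC oner_eq0.
by rewrite exprS mulnS; apply: msizeM1.
Qed.

Lemma nontrivial_kernel (K : fieldType) m n (A : 'M[K]_(m, n)) : (n < m)%N ->
  exists2 u : 'rV_m, u != 0 & u *m A = 0.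
Proof.
move=> lt_nm; have : kermx A != 0.
  by rewrite -mxrank_eq0 mxrank_ker -lt0n subn_gt0 (leq_ltn_trans (rank_leq_col A)).
move=> /rowV0Pn[u /sub_kermxP uA u0]; by exists u.
Qed.

(** There are more monomials in the [p i] with exponents below [D] than monomials that can occur in
    their values, so these values are linearly dependent. *)
Lemma algebraically_dependent (K : fieldType) d r (p : 'I_r -> {mpoly K[d]}) :
  (d < r)%N -> exists2 F : {mpoly K[r]}, F != 0 & mmap (@mpolyC d K) p F = 0.
Proof.
move=> lt_dr; pose delta := (\max_i msize (p i))%N.
have p_le i : (msize (p i) <= delta.+1)%N by apply/leqW/(leq_bigmax i).
(* [B] exceeds the degree of every value considered, and B^d <= ((r delta + 1) D)^d < D^(d+1) <=
   D^r, because (r delta + 1)^d is [D - 1]. *)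
pose D := ((r * delta).+1 ^ d).+1.
pose B := (r * delta * D).+1.
pose X (a : {ffun 'I_r -> 'I_D}) : 'X_{1..r} := [multinom (a i : nat) | i < r].
pose Y (b : {ffun 'I_d -> 'I_B}) : 'X_{1..d} := [multinom (b i : nat) | i < d].
have lt_card : (#|{: {ffun 'I_d -> 'I_B}}| < #|{: {ffun 'I_r -> 'I_D}}|)%N.
  rewrite !card_ffun !card_ord.
  have le_B : (B <= (r * delta).+1 * D)%N by rewrite /B /D; lia.
  apply: (@leq_ltn_trans (((r * delta).+1 * D) ^ d)); first by case: (d) => // d'; rewrite leq_exp2r.
  apply: (@leq_trans (D ^ d.+1)); last by rewrite leq_pexp2l.
  by rewrite expnMn expnS ltn_pmul2r // expn_gt0.
pose A := \matrix_(i < #|{: {ffun 'I_r -> 'I_D}}|, j < #|{: {ffun 'I_d -> 'I_B}}|)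
  (mmap1 p (X (enum_val i)))@_(Y (enum_val j)).
have [u u0 uA] := nontrivial_kernel A lt_card.
have X_inj : injective X.
  move=> a b /mnmP eq_ab; apply/ffunP=> i; apply: val_inj.
  by have := eq_ab i; rewrite !mnmE.
exists (\sum_i u 0 i *: 'X_[X (enum_val i)]).
  have /rV0Pn[i ui] := u0; apply: contraNneq ui => /(congr1 (mcoeff (X (enum_val i)))).
  rewrite mcoeff0 raddf_sum /= (bigD1 i) //= big1 ?addr0.
    by rewrite mcoeffZ mcoeffX eqxx mulr1 => ->.
  move=> j ji; rewrite mcoeffZ mcoeffX (inj_eq X_inj) (inj_eq enum_val_inj).
  by rewrite (negbTE ji) mulr0.
rewrite raddf_sum /=; apply/mpolyP=> m; rewrite mcoeff0 raddf_sum /=.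
have [m_lt | m_ge] := boolP [forall i, m i < B]%N.
  pose b : {ffun 'I_d -> 'I_B} := [ffun i => inord (m i)].
  have -> : m = Y b.
    by apply/mnmP=> i; rewrite mnmE ffunE inordK //; apply: (forallP m_lt).
  have /rowP/(_ (enum_rank b)) := uA; rewrite !mxE => eq0; rewrite -[RHS]eq0.
  by apply: eq_bigr => i _; rewrite mmapZ mmapX mcoeffCM mxE enum_rankK.
(* A monomial with an exponent at least [B] has too large a degree to occur. *)
rewrite big1 // => i _; rewrite mmapZ mmapX mcoeffCM.
rewrite [X in _ * X]memN_msupp_eq0 ?mulr0 //; apply: msize_mdeg_ge.
apply: leq_trans (msize_mmap1_le _ p_le) _.
move: m_ge; rewrite negb_forall => /existsP[j]; rewrite -leqNgt => le_Bm.
apply: (leq_trans _ (leq_trans le_Bm _)); last first.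
  by rewrite mdegE (bigD1 j) //= leq_addr.
rewrite /B ltnS -mulnA mulnCA leq_mul2l; apply/orP; right.
rewrite mdegE; apply: (@leq_trans (\sum_(k < r) D)%N).
  by apply: leq_sum => k _; rewrite mnmE; apply/ltnW.
by rewrite sum_nat_const card_ord.
Qed.

(** * Binomial edge ideals at the origin *)

Lemma mpoly_ring_ind (K : nzRingType) N (P : {mpoly K[N]} -> Prop) :
  (forall c, P c%:MP) -> (forall i, P 'X_i) ->
  (forall p q, P p -> P q -> P (p + q)) -> (forall p q, P p -> P q -> P (p * q)) ->
  forall p, P p.
Proof.
move=> PC PX PD PM p; rewrite (mpolyE p); apply: big_ind => // [|m _].
  by rewrite -mpolyC0; apply: PC.
rewrite -mul_mpolyC mpolyXE_id; apply: (PM) => //.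
apply: big_ind => [|q q'|i _]; [by rewrite -mpolyC1; apply: PC|exact: PM|].
elim: (m i) => [|k IHk]; first by rewrite expr0 -mpolyC1; apply: PC.
by rewrite exprS; apply: PM.
Qed.

Lemma mpoly_rmorph_eq (K T : nzRingType) N (f g : {rmorphism {mpoly K[N]} -> T}) :
  (forall c, f c%:MP = g c%:MP) -> (forall i, f 'X_i = g 'X_i) -> f =1 g.
Proof.
move=> fgC fgX; apply: mpoly_ring_ind => // p q fgp fgq.
  by rewrite !rmorphD fgp fgq.
by rewrite !rmorphM fgp fgq.
Qed.

Lemma mmap_var (K : nzRingType) (T : comNzRingType) N (f : {rmorphism K -> T})
  (h : 'I_N -> T) i : mmap f h 'X_i = h i.
Proof. by rewrite mmapX mmap1U. Qed.

Lemma kernel_prime (K : fieldType) N (T : idomainType) (f : {rmorphism {mpoly K[N]} -> T}) :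
  prime_ideal (fun p => f p = 0).
Proof.
split=> [|/eqP|p q /eqP]; last 2 first.
- by rewrite rmorph1 oner_eq0.
- by rewrite rmorphM mulf_eq0 => /orP[] /eqP; [left|right].
split=> [|p q fp fq|p q fq]; first exact: rmorph0.
  by rewrite rmorphD fp fq addr0.
by rewrite rmorphM fq mulr0.
Qed.

Lemma ideal_gen_ideal (K : fieldType) N (G : {mpoly K[N]} -> Prop) : is_ideal (ideal_gen G).
Proof.
split=> [I [I0 ID IM] GI // | f g If Ig I iI GI | f g Ig I iI GI];
  have [I0 ID IM] := iI.
- by apply: ID; [apply: If|apply: Ig].
- by apply: IM; apply: Ig.
Qed.

Section Origin.
Variables (K : fieldType) (N : nat).
Implicit Types p : {mpoly K[N]}.

Definition origin_ideal p : Prop := p@_0%MM = 0.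

Lemma origin_maximal : maximal_ideal origin_ideal.
Proof.
have [iM M1 _] := kernel_prime (@mcoeff N K 0%MM).
split=> // I [I0 ID IM] MI.
have [sIM | nsIM] := classic (subid I origin_ideal); first by left.
have [f nf] := not_all_ex_not _ _ nsIM; have [If Mf] := imply_to_and _ _ nf.
right; have f0 : f@_0%MM != 0 by apply/eqP.
have -> : 1 = (f@_0%MM)^-1%:MP * (f + (-1) * (f - (f@_0%MM)%:MP)) :> {mpoly K[N]}.
  have -> : f + (-1) * (f - (f@_0%MM)%:MP) = (f@_0%MM)%:MP by ring.
  by rewrite -mpolyCM mulVf.
apply: (IM); apply: ID => //; apply/IM/MI.
by rewrite /origin_ideal mcoeffB mcoeffC eqxx mulr1 subrr.
Qed.
End Origin.

Section Evaluation.
Variables (K : fieldType) (V : finType) (T : comNzRingType) (f : {rmorphism K -> T}).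
Variables (alpha beta : V -> T).
Local Notation m := #|V|.

Definition veval : {mpoly K[m + m]} -> T :=
  mmap f (fun i => match split i with
                   | inl j => alpha (enum_val j)
                   | inr j => beta (enum_val j) end).

HB.instance Definition _ := GRing.RMorphism.on veval.

Lemma veval_a v : veval (var_a K v) = alpha v.
Proof. by rewrite /veval mmap_var (unsplitK (inl _)) enum_rankK. Qed.

Lemma veval_b v : veval (var_b K v) = beta v.
Proof. by rewrite /veval mmap_var (unsplitK (inr _)) enum_rankK. Qed.

Lemma vevalC c : veval c%:MP = f c.
Proof. exact: mmapC. Qed.

Lemma veval_edge (E : rel V) p :
  (forall u v, E u v -> alpha u * beta v = alpha v * beta u) ->
  @binomial_edge_ideal K V E p -> veval p = 0.
Proof.
move=> Eab Jp; apply: (Jp (fun q => veval q = 0)) => [|g [u [v [Euv _ ->]]]].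
  split=> [|q q' e e'|q q' e]; first exact: rmorph0.
    by rewrite rmorphD /= e e' addr0.
  by rewrite rmorphM /= e mulr0.
by rewrite rmorphB !rmorphM /= !veval_a !veval_b Eab // subrr.
Qed.
End Evaluation.

Lemma var_case (K : fieldType) (V : finType) (P : {mpoly K[#|V| + #|V|]} -> Prop) :
  (forall v, P (var_a K v)) -> (forall v, P (var_b K v)) -> forall i, P 'X_i.
Proof.
move=> Pa Pb i; rewrite -(splitK i); case: (split i) => j /=.
  by have := Pa (enum_val j); rewrite /var_a enum_valK.
by have := Pb (enum_val j); rewrite /var_b enum_valK.
Qed.

Lemma veval_eq (K : fieldType) (V : finType) (T : comNzRingType)
  (f g : {rmorphism {mpoly K[#|V| + #|V|]} -> T}) :
  (forall c, f c%:MP = g c%:MP) -> (forall v, f (var_a K v) = g (var_a K v)) ->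
  (forall v, f (var_b K v) = g (var_b K v)) -> f =1 g.
Proof. by move=> fgC fga fgb; apply: mpoly_rmorph_eq => //; exact: (var_case (P := fun p => f p = g p)). Qed.

(** * A chain of primes below the origin *)

Section Height.
Variables (K : fieldType) (V : finType) (E : rel V).
Local Notation m := #|V|.
Local Notation J := (@binomial_edge_ideal K V E).
Local Notation M := (@origin_ideal K (m + m)).

Definition kill i (j : 'I_m.+1) : {mpoly K[m.+1]} := if (j < i)%N then 0 else 'X_j.

(** The map a_v -> s u_v, b_v -> u_v, with s the variable 0 and u_v the variable of index one plus
    the rank of [v], followed by killing the first [i] variables. Its kernels for [i] from 0 to |V|
    + 1 form the chain. *)
Definition chain_map i :=
  veval (@mpolyC m.+1 K) (fun v : V => kill i ord0 * kill i (lift ord0 (enum_rank v)))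
        (fun v => kill i (lift ord0 (enum_rank v))).

HB.instance Definition _ i := GRing.RMorphism.on (chain_map i).

Lemma kill_mul i j : mmap (@mpolyC m.+1 K) (kill i.+1) (kill i j) = kill i.+1 j.
Proof.
rewrite {2}/kill; case: ifP => [lt_ji|_]; last exact: mmap_var.
by rewrite rmorph0 /kill (leq_trans lt_ji).
Qed.

Lemma mpolyX_neq0 n (i : 'I_n) : 'X_i != 0 :> {mpoly K[n]}.
Proof. by rewrite -msize_poly_eq0 msizeX mdeg1. Qed.

Lemma height_binomial_edge_ideal : (0 < m)%N -> height_ge J M m.+1.
Proof.
move=> m_gt0; exists (fun i p => chain_map i p = 0); split=> i lt_im.
  split; first exact: kernel_prime.
    by move=> p; apply: veval_edge => u v _; ring.
  move=> p p0; have : (chain_map i p)@_0%MM = 0 by rewrite p0 mcoeff0.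
  suff /(_ p) /= -> : mcoeff 0%MM \o chain_map i =1 mcoeff 0%MM by [].
  have kill0 j : (kill i j)@_0%MM = 0.
    by rewrite /kill; case: ifP => _; rewrite ?mcoeff0 // mcoeffX mnm1_eq0.
  apply: veval_eq => [c|v|v] /=.
  - by rewrite /chain_map vevalC !mpolyCK.
  - by rewrite /chain_map veval_a rmorphM /= !kill0 mulr0 mcoeffX mnm1_eq0.
  - by rewrite /chain_map veval_b kill0 mcoeffX mnm1_eq0.
split=> [p p0|].
  suff /(_ p) /= <- : mmap (@mpolyC m.+1 K) (kill i.+1) \o chain_map i =1 chain_map i.+1.
    by rewrite p0 rmorph0.
  apply: veval_eq => [c|v|v] /=.
  - by rewrite /chain_map !vevalC mmapC.
  - by rewrite /chain_map !veval_a rmorphM /= !kill_mul.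
  - by rewrite /chain_map !veval_b kill_mul.
(* Strictness: killing s brings an a_v into the kernel, and killing u_v then brings in b_v. *)
case: i lt_im => [|i] lt_im sP.
  have := sP (var_a K (enum_val (Ordinal m_gt0))); rewrite /chain_map !veval_a.
  move/(_ _)/eqP; rewrite /kill /= mul0r mulf_eq0 !(negbTE (mpolyX_neq0 _)).
  by case/(_ erefl).
have := sP (var_b K (enum_val (Ordinal (lt_im : i < m)%N))); rewrite /chain_map !veval_b.
rewrite /kill enum_valK /= /bump /= add1n leqnn ltnn => /(_ erefl)/eqP.
by rewrite (negbTE (mpolyX_neq0 _)).
Qed.
End Height.

Lemma min_msupp (K : nzRingType) n (F : {mpoly K[n]}) : F != 0 ->
  exists2 m0, m0 \in msupp F & forall m, m \in msupp F -> m != m0 -> (m0 < m)%O.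
Proof.
rewrite -msupp_eq0; case: (msupp F) => // m s _.
elim: s m => [|m' s IHs] m.
  by exists m; rewrite ?mem_head // => m'; rewrite inE => ->.
have [m0 m0s m0_min] := IHs m'.
have [lt_m|le_m] := ltP m m0.
  exists m; rewrite ?mem_head // => m1; rewrite inE => /predU1P[->|m1s _].
    by rewrite eqxx.
  have [->//|ne_m1] := eqVneq m1 m0.
  exact: lt_trans lt_m (m0_min _ m1s ne_m1).
exists m0; first by rewrite inE m0s orbT.
move=> m1; rewrite inE => /predU1P[->|m1s]; last exact: m0_min.
by move=> ne_m; rewrite lt_neqAle eq_sym ne_m.
Qed.

(** * Regular sequences in the local ring at the origin *)

Section RegularSequence.
Variables (K : fieldType) (N : nat) (J : {mpoly K[N]} -> Prop).
Hypothesis iJ : is_ideal J.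
Local Notation M := (@origin_ideal K N).
Local Notation U := (fun t : {mpoly K[N]} => ~ M t).

Lemma origin_unit1 : U 1.
Proof. by rewrite /origin_ideal mcoeff1 eqxx => /eqP; rewrite oner_eq0. Qed.

Lemma origin_unitM s t : U s -> U t -> U (s * t).
Proof.
move=> /eqP s0 /eqP t0; apply/eqP.
by rewrite (rmorphM (@mcoeff N K 0%MM)) mulf_neq0.
Qed.

Lemma span_ideal_gen (ys ys' : seq {mpoly K[N]}) f : ys =i ys' ->
  ideal_span J ys f <-> ideal_gen (fun g => J g \/ g \in ys') f.
Proof.
move=> eq_ys; split; last first.
  move/(_ (ideal_span J ys)); apply; first exact: ideal_span_ideal.
  by move=> g [/span_base|]; last by rewrite -eq_ys; apply: span_mem.
suff gen zs : {subset zs <= ys'} -> ideal_span J zs f ->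
    ideal_gen (fun g => J g \/ g \in ys') f.
  by apply: gen => z; rewrite eq_ys.
have [G0 GD GM] := ideal_gen_ideal (fun g => J g \/ g \in ys').
elim: zs f => [|z zs IHzs] f sub /=; first by move=> Jf I _; apply; left.
move=> [a [b [Sa ->]]]; apply: GD.
  by apply: IHzs => // y zsy; apply: sub; rewrite inE zsy orbT.
rewrite mulrC; apply: GM => I _; apply; right.
by apply: sub; rewrite mem_head.
Qed.

(** The sequence is reversed, since [regular] has its last element at the head. *)
Lemma depth_regular r : depth_ge J M r -> exists ys,
  [/\ size ys = r, forall y, y \in ys -> M y & regular U J ys].
Proof.
case=> xs [sz Mxs xs_reg]; exists (rev xs); split; first by rewrite size_rev.
  by move=> y; rewrite mem_rev; apply: Mxs.
suff reg i : (i <= r)%N -> regular U J (rev (take i xs)).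
  by have := reg r (leqnn r); rewrite -sz take_size.
elim: i => [_|i IHi lt_ir]; first by rewrite take0.
rewrite (take_nth 0) ?sz // rev_rcons /=; split; first exact/IHi/ltnW.
have locE z : loc U (ideal_span J (rev (take i xs))) z <->
    loc_mem M (ideal_gen (fun g => J g \/ g \in take i xs)) z.
  have spanE g := @span_ideal_gen (rev (take i xs)) (take i xs) g (mem_rev _).
  by split=> [[t Ut /spanE It]|[t [Ut /spanE It]]]; exists t.
by move=> z /locE xz; apply/locE; apply: xs_reg xz.
Qed.

Lemma mmap1_mon (ys : seq {mpoly K[N]}) (m : 'X_{1..size ys}) :
  mmap1 (fun i : 'I_(size ys) => nth 0 ys i) m = mon ys m.
Proof.
rewrite /mmap1; under eq_bigr => i _ do rewrite (mnm_nth 0%N).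
have : size m = size ys by rewrite size_tuple.
move: (val m : seq nat) => s {m}; elim: ys s => [|y ys IHys] [|i s] //=.
  by rewrite big_ord0.
by case=> sz; rewrite big_ord_recl /= IHys.
Qed.

(** The smallest monomial [m0] of [F], by degree and then lexicographically, gives the leading term;
    all other terms are [higher], and [regular_annihilated] applies. *)
Lemma regular_independent ys (F : {mpoly K[size ys]}) f :
  regular U J ys -> F != 0 ->
  J (mmap (@mpolyC N K) (fun i : 'I_(size ys) => nth 0 ys i) F * f) ->
  forall n, loc U (filt J (fun=> True) ys n) f.
Proof.
move=> ys_reg F0 JFf; have [m0 m0F m0_min] := min_msupp F0.
pose r := \sum_(m <- msupp F | m != m0) (F@_m)%:MP_[N] * mon ys m.
have Fm0 : F@_m0 != 0 by rewrite -mcoeff_msupp.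
apply: (@regular_annihilated _ _ origin_unit1 origin_unitM _ iJ ys (F@_m0)%:MP m0 r) => //.
- by exists (F@_m0)^-1%:MP; rewrite -mpolyCM mulVf.
- by rewrite size_tuple.
- have [H0 HD HM] := higher_ideal iJ ys m0.
  rewrite /r big_seq_cond; apply: (big_ind (higher J ys m0)) => // m /andP[mF ne_m].
  apply: HM; apply: higher_mon; rewrite ?size_tuple //.
  have mdeg_sumn (m1 : 'X_{1..size ys}) : sumn m1 = mdeg m1 by rewrite /mdeg sumnE.
  have lt_m := m0_min m mF ne_m; rewrite !mdeg_sumn.
  have := lemc_mdeg (ltW lt_m); rewrite leq_eqVlt => /predU1P[eq_m|]; last by left.
  right; split=> //; have [k eq_nth lt_nth] := ltmcP eq_m lt_m.
  exists k => [j lt_jk|]; last by rewrite -!mnm_nth.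
  have := eq_nth (Ordinal (ltn_trans lt_jk (ltn_ord k))) lt_jk.
  by rewrite !(mnm_nth 0%N).
suff -> : (F@_m0)%:MP * mon ys m0 + r =
    mmap (@mpolyC N K) (fun i : 'I_(size ys) => nth 0 ys i) F by [].
rewrite /mmap (bigD1_seq m0) ?msupp_uniq //= mmap1_mon /r.
by under [in RHS]eq_bigr => m _ do rewrite mmap1_mon.
Qed.
End RegularSequence.

Lemma polyX_neq0 (D : nzRingType) : 'X != 0 :> {poly D}.
Proof. by rewrite polyX_eq0. Qed.

Lemma Xn_dvd_cancel (D : idomainType) n (p q h : {poly D}) :
  p.[0] != 0 -> p * q = 'X^n * h -> exists h', q = 'X^n * h'.
Proof.
move=> p0; elim: n q h => [|n IHn] q h pq; first by exists q; rewrite mul1r.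
have /factor_theorem[q1 def_q] : root q 0.
  have /eqP := congr1 (horner^~ 0) pq; rewrite exprS !hornerM hornerX !mul0r.
  by rewrite mulf_eq0 (negbTE p0).
rewrite subr0 in def_q; have [|h' def_q1] := IHn q1 h.
  apply: (mulfI (polyX_neq0 D)); rewrite [RHS]mulrA -exprS -pq def_q; ring.
by exists h'; rewrite def_q def_q1 exprS; ring.
Qed.

Lemma mulr_subDD (R : comNzRingType) (x x' y y' s : R) :
  (x + x' - (y + y')) * s = (x - y) * s + (x' - y') * s.
Proof. by ring. Qed.

Lemma mulr_subMM (R : comNzRingType) (x x' y y' s : R) :
  (x * x' - y * y') * s = x' * ((x - y) * s) + y * ((x' - y') * s).
Proof. by ring. Qed.

(** * The depth is at most twice the size of one side *)

Section Graph.
Variables (K : fieldType) (V : finType) (E : rel V) (A : {set V}) (w w' : V -> V).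
Hypotheses (E_sym : ssrbool.symmetric E) (A_indep : forall u v, E u v -> u \in A -> v \notin A).
Hypotheses (ww' : forall v, v \notin A ->
  [/\ w v \in A, w' v \in A, w v != w' v, E v (w v) & E v (w' v)]).
Local Notation m := #|V|.
Local Notation J := (@binomial_edge_ideal K V E).
Local Notation M := (@origin_ideal K (m + m)).
Local Notation a := (var_a K).
Local Notation b := (var_b K).

Let iJ : is_ideal J := ideal_gen_ideal _.

Lemma edge_in_ideal u v : E u v -> J (a u * b v - a v * b u).
Proof.
have [_ _ JM] := iJ.
move=> Euv; have [lt_uv|lt_vu|eq_uv] := ltngtP (enum_rank u) (enum_rank v).
- by move=> I iI; apply; exists u, v.
- have -> : a u * b v - a v * b u = (-1) * (a v * b u - a u * b v) by ring.
  by apply: JM => I iI; apply; exists v, u; rewrite E_sym.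
- have /enum_rank_inj -> := val_inj eq_uv; rewrite subrr; by case: iJ.
Qed.

Definition separator := \prod_(v | v \notin A) (a (w v) * b (w' v) - a (w' v) * b (w v)).

(** A 3x3 determinant with a repeated row, on the columns [v], [w v], [w' v], vanishes: this writes
    a_v or b_v times the minor of [w v] and [w' v] through the minors of the two edges at [v]. *)
Lemma separator_kills v : v \notin A -> J (a v * separator) /\ J (b v * separator).
Proof.
move=> vA; have [_ JD JM] := iJ; have [_ _ _ Ew Ew'] := ww' vA.
have e1 := edge_in_ideal Ew; have e2 := edge_in_ideal Ew'.
rewrite /separator (bigD1 v) //=; set R := \prod_(i | _) _.
set e := _ - _ in e1; set e' := _ - _ in e2; split.
  have -> : a v * ((a (w v) * b (w' v) - a (w' v) * b (w v)) * R) =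
    (R * a (w v)) * e' + (- R * a (w' v)) * e by rewrite /e /e'; ring.
  by apply: JD; apply: JM.
have -> : b v * ((a (w v) * b (w' v) - a (w' v) * b (w v)) * R) =
  (R * b (w v)) * e' + (- R * b (w' v)) * e by rewrite /e /e'; ring.
by apply: JD; apply: JM.
Qed.

Section Restriction.
Variables (v0 : V) (v0A : v0 \in A).
Let d := #|A|.

Definition restrict := veval (@mpolyC (d + d) K)
  (fun v => if v \in A then 'X_(lshift d (enum_rank_in v0A v)) else 0)
  (fun v => if v \in A then 'X_(rshift d (enum_rank_in v0A v)) else 0).

HB.instance Definition _ := GRing.RMorphism.on restrict.

Definition extend : {mpoly K[d + d]} -> {mpoly K[m + m]} :=
  mmap (@mpolyC (m + m) K) (fun i => match split i with
                   | inl j => a (enum_val j)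
                   | inr j => b (enum_val j) end).

HB.instance Definition _ := GRing.RMorphism.on extend.

(** [extend] is a section of [restrict], and [p - extend (restrict p)] lies in the ideal of the
    variables outside [A], which [separator] multiplies into [J]. *)
Lemma separator_restrict g : restrict g = 0 -> J (g * separator).
Proof.
suff /(_ g) Jg p : J ((p - extend (restrict p)) * separator).
  by move=> g0; move: Jg; rewrite g0 rmorph0 subr0.
have [J0 JD JM] := iJ.
apply: (@mpoly_ring_ind _ _ (fun p => J ((p - extend (restrict p)) * separator))).
- by move=> c; rewrite /restrict vevalC /extend mmapC subrr mul0r.
- apply: (var_case (P := fun p => J ((p - extend (restrict p)) * separator))) => v.
    rewrite {1}/restrict veval_a; case: ifP => [vA|/negbT vA].
      by rewrite /extend mmap_var (unsplitK (inl _)) enum_rankK_in // subrr mul0r.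
    by rewrite rmorph0 subr0; case: (separator_kills vA).
  rewrite {1}/restrict veval_b; case: ifP => [vA|/negbT vA].
    by rewrite /extend mmap_var (unsplitK (inr _)) enum_rankK_in // subrr mul0r.
  by rewrite rmorph0 subr0; case: (separator_kills vA).
- move=> q q' Jq Jq'; rewrite !rmorphD /=.
  set r := extend _ in Jq *; set r' := extend _ in Jq' *.
  have -> : (q + q' - (r + r')) * separator =
    (q - r) * separator + (q' - r') * separator by exact: mulr_subDD.
  exact: JD.
- move=> q q' Jq Jq'; rewrite !rmorphM /=.
  set r := extend _ in Jq *; set r' := extend _ in Jq' *.
  have -> : (q * q' - r * r') * separator =
    q' * ((q - r) * separator) + r * ((q' - r') * separator) by exact: mulr_subMM.
  by apply: JD; apply: JM.
Qed.
End Restriction.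

Lemma separator_in_filtration ys : (#|A| + #|A| < size ys)%N -> A != set0 ->
  regular (fun t => ~ M t) J ys ->
  forall n, loc (fun t => ~ M t) (filt J (fun=> True) ys n) separator.
Proof.
move=> lt_A /set0Pn[v0 v0A] ys_reg.
have [F F0 relF] := algebraically_dependent
  (fun i : 'I_(size ys) => restrict v0A (nth 0 ys i)) lt_A.
apply: regular_independent F0 _ => //; apply: (@separator_restrict _ v0A).
rewrite -[RHS]relF.
apply: (mpoly_rmorph_eq (f := restrict v0A \o mmap _ _) (g := mmap _ _)) => [c|i] /=.
  by rewrite !mmapC /restrict vevalC.
by rewrite !mmap_var.
Qed.

(* The rational curves a_v = T, b_v = T Y^v (v in A) through the origin, on
   which [separator] does not vanish identically. *)
Definition curve := veval (polyC \o @polyC K : {rmorphism K -> {poly {poly K}}})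
  (fun v => if v \in A then 'X else 0)
  (fun v => if v \in A then ('X^(enum_rank v))%:P * 'X else 0).

HB.instance Definition _ := GRing.RMorphism.on curve.

Lemma curve_edge p : J p -> curve p = 0.
Proof.
apply: veval_edge => u v Euv; have := A_indep Euv.
by do 2 case: (_ \in A); rewrite ?(mul0r, mulr0) // => /(_ isT).
Qed.

Lemma curve0 p : (curve p).[0] = (p@_0%MM)%:P.
Proof.
apply: (veval_eq (f := horner_eval 0 \o curve) (g := polyC \o mcoeff 0%MM)) => [c|v|v] /=.
- by rewrite /curve vevalC /horner_eval /= hornerC mpolyCK.
- rewrite /curve veval_a /horner_eval mcoeffX mnm1_eq0.
  by case: ifP; rewrite ?hornerX ?hornerC.
- rewrite /curve veval_b /horner_eval mcoeffX mnm1_eq0.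
  by case: ifP; rewrite ?hornerM ?hornerX ?mulr0 ?hornerC.
Qed.

Lemma curve_separator : curve separator != 0.
Proof.
rewrite rmorph_prod /=; apply/prodf_neq0 => v vA.
have [wA w'A ww'v _ _] := ww' vA.
rewrite rmorphB !rmorphM /= /curve !veval_a !veval_b wA w'A subr_eq0.
apply: contraNneq ww'v => /(mulfI (polyX_neq0 _)) /(mulIf (polyX_neq0 _)) /polyC_inj.
move=> /(congr1 (fun p : {poly K} => size p)); rewrite !size_polyXn => -[].
by move=> /val_inj /enum_rank_inj ->.
Qed.

Lemma depth_binomial_edge_ideal r : depth_ge J M r -> A != set0 -> (r <= #|A| + #|A|)%N.
Proof.
move=> /(depth_regular iJ)[ys [sz Mys ys_reg]] A0; rewrite leqNgt; apply/negP => lt_A.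
rewrite -sz in lt_A.
(* The chosen power is the size of [curve separator], one more than its degree, so that ['X] to this
   power cannot divide it. *)
have [t Ut Qt] := separator_in_filtration lt_A A0 ys_reg (size (curve separator)).
have [h e] : exists h, curve (t * separator) = 'X^(size (curve separator)) * h.
  apply: (filt_order (J := J) _ _ Qt) => [|y ysy]; first exact: curve_edge.
  have /factor_theorem[h def_y] : root (curve y) 0.
    by apply/eqP; rewrite curve0 (Mys y ysy).
  by exists h; rewrite /= def_y subr0 mulrC.
rewrite rmorphM /= in e.
(* [t] has a nonzero constant term, hence so has [curve t], and the power of ['X] divides the other
   factor. *)
have [|h' def_h'] := Xn_dvd_cancel _ e.
  by rewrite curve0 polyC_eq0; apply/eqP.
have h'0 : h' != 0.
  by apply: contraNneq curve_separator => h'0; rewrite def_h' h'0 mulr0.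
have /= := congr1 (fun p : {poly {poly K}} => size p) def_h'.
rewrite size_monicM ?monicXn // size_polyXn.
by have := h'0; rewrite -size_poly_gt0; move: (size h') (size (curve _)) => x y; lia.
Qed.

Lemma small_side_not_cohen_macaulay : (0 < m)%N -> (#|A| + #|A| <= m)%N ->
  ~ cohen_macaulay_quot J.
Proof.
move=> m_gt0 le_A /(_ M (@origin_maximal K _)) cm.
have JM : subid J M.
  move=> p /curve_edge p0; apply/eqP; rewrite -polyC_eq0 -curve0 p0 horner0 //.
have A0 : A != set0.
  have [v vA | noA] := pickP [pred v | v \notin A].
    by have [wA _ _ _ _] := ww' vA; apply/set0Pn; exists (w v).
  have /card_gt0P[v _] := m_gt0.
  by apply/set0Pn; exists v; have := noA v; rewrite /= => /negbFE.
have /depth_binomial_edge_ideal/(_ A0) := (cm JM m.+1).2 (height_binomial_edge_ideal _ _ m_gt0).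
by rewrite leqNgt ltnS le_A.
Qed.
End Graph.

Lemma bipartite_not_cohen_macaulay (K : fieldType) (V : finType) (E : rel V) (A : {set V}) :
  (0 < #|V|)%N -> ssrbool.symmetric E -> (forall u v, E u v -> (u \in A) != (v \in A)) ->
  (forall v, exists w w', [/\ w != w', E v w & E v w']) ->
  ~ cohen_macaulay_quot (@binomial_edge_ideal K V E).
Proof.
(* The complement of [A] satisfies the same hypotheses, so the smaller side may be chosen. *)
move=> V_gt0 E_sym EA deg2; wlog le_A : A EA / (#|A| + #|A| <= #|V|)%N.
  move=> main; have [le_A|lt_A] := leqP (#|A| + #|A|) #|V|; first exact: (main A).
  apply: (main (~: A)); first by move=> u v /EA; rewrite !inE (inj_eq negb_inj).
  by move: lt_A; rewrite -(cardsC A); lia.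
have [w /= w_deg] := fin_all_exists deg2.
have [w' ww'] := fin_all_exists w_deg.
apply: (@small_side_not_cohen_macaulay K V E A w w') => // [u v /EA|v vA].
  by case: (u \in A) => //; rewrite eqbF_neg negbK.
have [ne_w Ew Ew'] := ww' v; split=> //.
  by have := EA _ _ Ew; rewrite (negbTE vA); case: (_ \in A).
by have := EA _ _ Ew'; rewrite (negbTE vA); case: (_ \in A).
Qed.

(** * Levi graphs of conic-line arrangements *)

Lemma ord3P (P : 'I_3 -> Prop) : P 0 -> P 1 -> P 2%:R -> forall i, P i.
Proof.
move=> P0 P1 P2 [[|[|[|//]]] lti].
- by rewrite (_ : Ordinal lti = 0) //; apply: val_inj.
- by rewrite (_ : Ordinal lti = 1) //; apply: val_inj.
- by rewrite (_ : Ordinal lti = 2%:R) //; apply: val_inj.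
Qed.

Lemma sum3 (R : nmodType) (F : 'I_3 -> R) : \sum_i F i = F 0 + F 1 + F 2%:R.
Proof.
rewrite !big_ord_recl big_ord0 addr0 addrA.
by congr (F _ + F _ + F _); apply: val_inj.
Qed.

(** * Incidence and polarity in the projective plane *)

Section Plane.
Variable C : fieldType.
Implicit Types (p q u v l : 'rV[C]_3) (Q : 'M[C]_3).

Lemma proportionalP u v :
  reflect (forall i j, u 0 i * v 0 j = u 0 j * v 0 i) (proportional u v).
Proof. by apply: (iffP 'forall_forallP) => uv i j; apply/eqP; apply: uv. Qed.

Lemma proportional_sym u v : proportional u v = proportional v u.
Proof.
by apply/proportionalP/proportionalP => uv i j; rewrite mulrC -uv mulrC.
Qed.

Lemma proportional_trans u v q : v != 0 ->
  proportional u v -> proportional v q -> proportional u q.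
Proof.
move=> /rV0Pn[k vk] /proportionalP uv /proportionalP vq; apply/proportionalP => i j.
apply: (mulIf vk); apply: (mulIf vk).
transitivity ((u 0 i * v 0 k) * (v 0 k * q 0 j)); first ring.
transitivity ((u 0 j * v 0 k) * (v 0 k * q 0 i)); last ring.
by rewrite (uv i k) (uv j k) (vq k j) (vq k i); ring.
Qed.

Lemma proportional0 v : proportional 0 v.
Proof. by apply/proportionalP => i j; rewrite !mxE !mul0r. Qed.

Lemma proportional_scale u v : u != 0 -> proportional v u -> exists c, v = c *: u.
Proof.
move=> /rV0Pn[k uk] /proportionalP vu; exists (v 0 k / u 0 k).
by apply/rowP=> i; rewrite mxE mulrAC vu mulfK.
Qed.

Lemma on_lineE l p : on_line l p =
  (p 0 0 * l 0 0 + p 0 1 * l 0 1 + p 0 2%:R * l 0 2%:R == 0).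
Proof. by rewrite /on_line mxE sum3 !mxE. Qed.

Lemma on_lineC u v : on_line u v = on_line v u.
Proof. by rewrite !on_lineE; congr (_ == 0); ring. Qed.

(** Both [u] and [v] are proportional to the cross product [c] of [p] and [q], which is nonzero
    because [p] and [q] are not proportional. *)
Lemma orthogonal_proportional u v p q : ~~ proportional p q ->
  on_line u p -> on_line u q -> on_line v p -> on_line v q -> proportional u v.
Proof.
rewrite !(on_lineC _ p) !(on_lineC _ q) !on_lineE => pq /eqP pu /eqP qu /eqP pv /eqP qv.
pose c01 := p 0 0 * q 0 1 - p 0 1 * q 0 0.
pose c12 := p 0 1 * q 0 2%:R - p 0 2%:R * q 0 1.
pose c20 := p 0 2%:R * q 0 0 - p 0 0 * q 0 2%:R.
pose c := \row_(i < 3) (if i == 0 then c12 else if i == 1 then c20 else c01) : 'rV[C]_3.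
have c_prop (x : 'rV[C]_3) : x 0 0 * p 0 0 + x 0 1 * p 0 1 + x 0 2%:R * p 0 2%:R = 0 ->
    x 0 0 * q 0 0 + x 0 1 * q 0 1 + x 0 2%:R * q 0 2%:R = 0 -> proportional x c.
  move=> xp xq.
  have e01 : x 0 0 * c20 = x 0 1 * c12.
    apply/eqP; rewrite -subr_eq0; apply/eqP; rewrite /c20 /c12.
    transitivity (p 0 2%:R * (x 0 0 * q 0 0 + x 0 1 * q 0 1 + x 0 2%:R * q 0 2%:R)
      - q 0 2%:R * (x 0 0 * p 0 0 + x 0 1 * p 0 1 + x 0 2%:R * p 0 2%:R)); first ring.
    by rewrite xp xq; ring.
  have e02 : x 0 0 * c01 = x 0 2%:R * c12.
    apply/eqP; rewrite -subr_eq0; apply/eqP; rewrite /c01 /c12.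
    transitivity (q 0 1 * (x 0 0 * p 0 0 + x 0 1 * p 0 1 + x 0 2%:R * p 0 2%:R)
      - p 0 1 * (x 0 0 * q 0 0 + x 0 1 * q 0 1 + x 0 2%:R * q 0 2%:R)); first ring.
    by rewrite xp xq; ring.
  have e12 : x 0 1 * c01 = x 0 2%:R * c20.
    apply/eqP; rewrite -subr_eq0; apply/eqP; rewrite /c01 /c20.
    transitivity (p 0 0 * (x 0 0 * q 0 0 + x 0 1 * q 0 1 + x 0 2%:R * q 0 2%:R)
      - q 0 0 * (x 0 0 * p 0 0 + x 0 1 * p 0 1 + x 0 2%:R * p 0 2%:R)); first ring.
    by rewrite xp xq; ring.
  by apply/proportionalP; apply: ord3P; apply: ord3P; rewrite !mxE.
have c0 : c != 0.
  apply: contraNneq pq => c0; have cE i := congr1 (fun x : 'rV[C]_3 => x 0 i) c0.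
  have := cE 0; have := cE 1; have := cE 2%:R; rewrite !mxE /= => /subr0_eq e01 /subr0_eq e20.
  move=> /subr0_eq e12.
  by apply/proportionalP; apply: ord3P; apply: ord3P; rewrite ?e01 ?e20 ?e12.
apply: (proportional_trans c0); first exact: c_prop.
by rewrite proportional_sym; apply: c_prop.
Qed.

Lemma on_line_comb l u v a b : on_line l u -> on_line l v -> on_line l (a *: u + b *: v).
Proof.
move=> /eqP lu /eqP lv.
by rewrite /on_line mulmxDl -!scalemxAl mxE [X in X + _]mxE [X in _ + X]mxE lu lv !mulr0 addr0.
Qed.

Lemma line_points l : l != 0 ->
  exists u v, [/\ on_line l u, on_line l v & ~~ proportional u v].
Proof.
move=> /rV0Pn[k]; pose row x y z :=
  \row_(i < 3) (if i == 0 then x else if i == 1 then y else z) : 'rV[C]_3.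
move: k; apply: ord3P => lk.
- exists (row (- l 0 1) (l 0 0) 0), (row (- l 0 2%:R) 0 (l 0 0)).
  split; rewrite ?on_lineE ?mxE /=; [by apply/eqP; ring|by apply/eqP; ring|].
  apply/negP => /proportionalP/(_ 1 2%:R)/eqP; rewrite !mxE /= mul0r mulf_eq0.
  by rewrite (negbTE lk).
- exists (row (l 0 1) (- l 0 0) 0), (row 0 (- l 0 2%:R) (l 0 1)).
  split; rewrite ?on_lineE ?mxE /=; [by apply/eqP; ring|by apply/eqP; ring|].
  apply/negP => /proportionalP/(_ 0 2%:R)/eqP; rewrite !mxE /= mul0r mulf_eq0.
  by rewrite (negbTE lk).
- exists (row (l 0 2%:R) 0 (- l 0 0)), (row 0 (l 0 2%:R) (- l 0 1)).
  split; rewrite ?on_lineE ?mxE /=; [by apply/eqP; ring|by apply/eqP; ring|].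
  apply/negP => /proportionalP/(_ 0 1)/eqP; rewrite !mxE /= mul0r mulf_eq0.
  by rewrite (negbTE lk).
Qed.

Definition polar Q u v : C := (u *m Q *m v^T) 0 0.

Lemma polarC Q u v : Q^T = Q -> polar Q u v = polar Q v u.
Proof.
move=> symQ; transitivity ((u *m Q *m v^T)^T 0 0); first by rewrite [RHS]mxE.
by rewrite !trmx_mul trmxK symQ mulmxA.
Qed.

Lemma polarDl Q u v q a b :
  polar Q (a *: u + b *: v) q = a * polar Q u q + b * polar Q v q.
Proof.
rewrite /polar !mulmxDl -!scalemxAl.
by rewrite [LHS]mxE [X in X + _]mxE [X in _ + X]mxE.
Qed.

Lemma polar_comb Q u v a b : Q^T = Q ->
  polar Q (a *: u + b *: v) (a *: u + b *: v) =
    a ^+ 2 * polar Q u u + a * b * polar Q u v *+ 2 + b ^+ 2 * polar Q v v.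
Proof.
move=> symQ; rewrite polarDl !(polarC _ (a *: u + b *: v)) // !polarDl.
by rewrite (polarC v u symQ); ring.
Qed.

Lemma on_line_polar Q p q : on_line (p *m Q) q = (polar Q p q == 0).
Proof.
rewrite /on_line /polar; congr (_ == 0).
by rewrite -[in RHS](trmxK (p *m Q)) -trmx_mul [in RHS]mxE.
Qed.

Lemma proportional_comb u v a b : a != 0 ->
  proportional u (a *: v + b *: u) -> proportional u v.
Proof.
move=> a0 /proportionalP uv; apply/proportionalP => i j; apply: (mulfI a0).
have := uv i j; rewrite !mxE => e; apply/eqP; rewrite -subr_eq0; apply/eqP.
transitivity (u 0 i * (a * v 0 j + b * u 0 j) - u 0 j * (a * v 0 i + b * u 0 i)).
  by ring.
by rewrite e subrr.
Qed.
End Plane.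

Lemma transversal_conic_points (C : numClosedFieldType) (l : 'rV[C]_3) (Q : 'M[C]_3) :
  l != 0 -> Q^T = Q ->
  (forall p, p != 0 -> on_line l p -> on_conic Q p -> ~~ proportional l (p *m Q)) ->
  exists p p', [/\ on_line l p /\ on_conic Q p, on_line l p' /\ on_conic Q p'
                 & ~~ proportional p p'].
Proof.
move=> l0 symQ transv; have [u [v [lu lv uv]]] := line_points l0.
have [p [w [lp lw pw Qp]]] : exists p w,
    [/\ on_line l p, on_line l w, ~~ proportional p w & on_conic Q p].
  have [Qu|Qu] := boolP (on_conic Q u); first by exists u, v.
  (* Coefficients of the monic quadratic for [x] expressing that [x *: u + v] lies on the conic; its
     leading coefficient is nonzero as [u] does not. *)
  pose c i := if i is 0 then - (polar Q v v / polar Q u u)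
              else - (polar Q u v *+ 2 / polar Q u u).
  have [x] := @solve_monicpoly C 2 c isT.
  rewrite !big_ord_recl big_ord0 /= expr0 mulr1 addr0 expr1 => def_x.
  exists (x *: u + 1 *: v), u; split=> //; first exact: on_line_comb.
    apply: contra uv => uv; rewrite addrC proportional_sym in uv.
    by apply: proportional_comb uv; apply: oner_neq0.
  have Qu' : polar Q u u != 0 by [].
  rewrite /on_conic -/(polar Q _ _) polar_comb // def_x; apply/eqP; field.
  exact: Qu'.
have Qpp : polar Q p p = 0 by apply/eqP.
have p0 : p != 0 by apply: contraNneq pw => ->; apply: proportional0.
have pw0 : polar Q p w != 0.
  (* Otherwise the polar line of [p] passes through [p] and [w], so it is [l], against
     transversality. *)
  apply: contraNneq (transv p p0 lp Qp) => pw0.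
  by apply: (orthogonal_proportional pw); rewrite // on_line_polar ?Qpp ?pw0.
(* On a w + b p the form equals a (a Q(w,w) + 2 b Q(p,w)), since Q(p,p) = 0; the second factor
   vanishes for a = 2 Q(p,w), b = - Q(w,w), and this a is nonzero in characteristic 0. *)
pose a := polar Q p w *+ 2; exists p, (a *: w + (- polar Q w w) *: p); split=> //.
  split; first exact: on_line_comb.
  rewrite /on_conic -/(polar Q _ _) polar_comb // Qpp (polarC w p symQ) /a.
  by apply/eqP; ring.
by apply: contra pw; apply: proportional_comb; rewrite mulrn_eq0.
Qed.

(** * Every vertex of the Levi graph has two neighbours *)

Section Levi.
Variables (C : numClosedFieldType) (n k : nat).
Variables (lines : 'I_n -> 'rV[C]_3) (conics : 'I_k -> 'M[C]_3).
Hypothesis arr : conic_line_arrangement lines conics.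
Variables (s : nat) (pts : 'I_s -> 'rV[C]_3).
Hypothesis pts_sing : enumerates_sing lines conics pts.

Lemma on_curve_proportional c p q : p != 0 -> proportional q p ->
  on_curve lines conics c p -> on_curve lines conics c q.
Proof.
move=> p0 /(proportional_scale p0)[x ->]; case: c => j /= /eqP jp.
  by rewrite /on_line -scalemxAl mxE jp mulr0.
by rewrite /on_conic linearZ /= -!scalemxAl -scalemxAr mxE [X in _ * X]mxE jp !mulr0.
Qed.

Lemma line_meets_conic j j' : exists p p',
  [/\ on_curve lines conics (inl j) p /\ on_curve lines conics (inr j') p,
      on_curve lines conics (inl j) p' /\ on_curve lines conics (inr j') p'
    & ~~ proportional p p'].
Proof.
have [l0 _ smooth _ transv] := arr; have [symQ _] := smooth j'.
apply: transversal_conic_points => // p p0 jp j'p.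
exact: (transv p (inl j) (inr j')).
Qed.

Lemma curve_points : (1 <= n)%N -> (1 <= k)%N -> forall c, exists i i',
  [/\ i != i', on_curve lines conics c (pts i) & on_curve lines conics c (pts i')].
Proof.
move=> n_gt0 k_gt0 c; have [singP distinct complete] := pts_sing.
(* The curve [c] is paired with some curve of the other kind; the two intersection points of this
   line and conic are the required singular points. *)
have [j [j' c_jj']] : exists j j', c = inl j \/ c = inr j'.
  case: c => [j|j']; first by exists j, (Ordinal k_gt0); left.
  by exists (Ordinal n_gt0), j'; right.
have on_c p : on_curve lines conics (inl j) p /\ on_curve lines conics (inr j') p ->
    on_curve lines conics c p by case: c_jj' => -> [].
have [p [p' [jp jp' pp']]] := line_meets_conic j j'.
have p0 : p != 0 by apply: contraNneq pp' => ->; apply: proportional0.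
have p'0 : p' != 0.
  by apply: contraNneq pp' => ->; rewrite proportional_sym proportional0.
have sing q : q != 0 -> on_curve lines conics (inl j) q /\ on_curve lines conics (inr j') q ->
    is_sing lines conics q.
  by move=> q0 [jq j'q]; split=> //; exists (inl j), (inr j').
have [i pi] := complete p (sing p p0 jp).
have [i' pi'] := complete p' (sing p' p'0 jp').
exists i, i'; split.
- apply: contraNneq pp' => eq_i; apply: (proportional_trans _ pi).
    by have [] := singP i.
  by rewrite eq_i proportional_sym.
- by apply: (on_curve_proportional p0); [rewrite proportional_sym|apply: on_c].
- by apply: (on_curve_proportional p'0); [rewrite proportional_sym|apply: on_c].
Qed.

Lemma levi_degree : (1 <= n)%N -> (1 <= k)%N -> forall v, exists w w',
  [/\ w != w', levi_graph lines conics pts v w & levi_graph lines conics pts v w'].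
Proof.
move=> n_gt0 k_gt0 [i|c].
  have [singP _ _] := pts_sing; have [_ [c [c' [cc' [ci c'i]]]]] := singP i.
  by exists (inr c), (inr c').
have [i [i' [ii' ci ci']]] := curve_points n_gt0 k_gt0 c.
by exists (inl i), (inl i').
Qed.
End Levi.

Theorem theorem4p9 (R : realType) (K : fieldType) (n k : nat)
  (lines : 'I_n -> 'rV[R[i]]_3) (conics : 'I_k -> 'M[R[i]]_3)
  (s : nat) (pts : 'I_s -> 'rV[R[i]]_3) :
  (1 <= n)%N -> (1 <= k)%N ->
  conic_line_arrangement lines conics ->
  enumerates_sing lines conics pts ->
  ~ cohen_macaulay_quot
      (@binomial_edge_ideal K _ (levi_graph lines conics pts)).
Proof.
move=> n_gt0 k_gt0 arr pts_sing.
(* The two sides are the singular points and the curves. *)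
apply: (bipartite_not_cohen_macaulay
          (A := [set v : levi_vertex s n k | if v is inl _ then true else false])).
- by apply/card_gt0P; exists (inr (inl (Ordinal n_gt0))).
- by move=> [i|c] [i'|c'].
- by move=> [i|c] [i'|c'] //=; rewrite !inE.
- exact: levi_degree.
Qed.
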